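(* Let $p$ be a prime, $k\geq 1$, and $K=\mathbb{F}_{p^k}$. Let $m\geq 1$ be an integer such that $K$ contains all $m$th roots of unity (i.e. $m\mid p^k-1$), and put $d=(p^k-1)/m$. Assume that $m\neq 1$ and $(m,k)\neq(2,1)$. Then for every integer $n>d$, the equation $x_1^d+\cdots+x_n^d=0$ has a solution $(x_1,\dots,x_n)\in K^n$ with $x_i\neq 0$ for every $i$. In other words, the weight set $W_p(m)$ contains every integer $n\geq d+1$.
   Context: For a prime $p$ and a positive integer $m$, $W_p(m)$ denotes the set of integers $n\geq 0$ for which there exist $\alpha_1,\dots,\alpha_n$ in the algebraic closure $\overline{\mathbb{F}}_p$ with $\alpha_i^m=1$ for all $i$ (repetitions allowed) and $\alpha_1+\cdots+\alpha_n=0$ (the empty sum gives $0\in W_p(m)$). *)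

(* Defs.v *)
From HB Require Import structures.
From mathcomp Require Import all_boot all_order all_algebra all_field.

Set Implicit Arguments.
Unset Strict Implicit.
Unset Printing Implicit Defensive.

Import GRing.Theory.
Local Open Scope ring_scope.

(* 'F_p is the field with p elements only when p is prime (it is built from
   the least prime divisor of p), so Fpbar p and weight_set p m are meant for
   prime p. *)
Definition Fpbar (p : nat) : closedFieldType :=
  tag (countable_algebraic_closure 'F_p).

Definition weight_set (p m n : nat) : Prop :=
  exists alpha : 'I_n -> Fpbar p,
    (forall i, alpha i ^+ m = 1) /\ \sum_(i < n) alpha i = 0.

(* Main.v *)
Require Import Defs.
From HB Require Import structures.
From mathcomp Require Import all_boot all_order all_algebra all_field.
From mathcomp Require Import cyclic zify.

(* Let S_n be the set of n-fold sums of m-th roots of unity in K. It is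
   invariant under multiplication by a primitive root z, so m divides
   #|S_n \ 0|. If m >= 3 and this number fails to increase from n to n + 1, then
   S_(n+1) is S_n + 1 with at most one added point c, and comparing sums and sums
   of squares forces c = 0 or c = 1; hence B and B + 1 are both z-invariant for
   B = S_n or B = S_n with 0 added, which makes B the F_p-span of the roots of
   unity. Either way -1 lies in S_n for n >= d, so 0 lies in S_(n+1). For m = 2
   the sums of signs are explicit, since d >= p. *)

Set Implicit Arguments.
Unset Strict Implicit.
Unset Printing Implicit Defensive.

Import GRing.Theory.
Local Open Scope ring_scope.

(** * Subsets of a finite field stable under multiplication by a root of unity *)

Section RootSums.

Variables (K : finFieldType) (m : nat) (z : K).
Hypothesis z_prim : m.-primitive_root z.

Let m_gt0 : (0 < m)%N := prim_order_gt0 z_prim.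

Let z_neq0 : z != 0.
Proof.
apply/eqP=> z0; have := prim_expr_order z_prim.
by move/eqP; rewrite z0 expr0n gtn_eqF // eq_sym oner_eq0.
Qed.

Definition mul_stable (B : {set K}) := forall x, (z * x \in B) = (x \in B).

Lemma mul_stable_expr B i x : mul_stable B -> (z ^+ i * x \in B) = (x \in B).
Proof.
move=> Bz; elim: i => [|i IHi]; rewrite ?expr0 ?mul1r //.
by rewrite exprS -mulrA Bz.
Qed.

Lemma mul_stableP (B : {set K}) :
  (forall x, x \in B -> z * x \in B) -> mul_stable B.
Proof.
move=> Bz x; apply/idP/idP => [zxB|]; last exact: Bz.
have Bzi i y : y \in B -> z ^+ i * y \in B.
  by elim: i => [|i IHi] By; rewrite ?expr0 ?mul1r // exprS -mulrA Bz ?IHi.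
have := Bzi m.-1 _ zxB.
by rewrite mulrA -exprSr prednK // prim_expr_order // mul1r.
Qed.

Lemma mul_stableD1 B : mul_stable B -> mul_stable (B :\ 0).
Proof. by move=> Bz x; rewrite !inE Bz mulf_eq0 (negPf z_neq0). Qed.

Lemma mul_stableU0 B : mul_stable B -> mul_stable (0 |: B).
Proof. by move=> Bz x; rewrite !inE Bz mulf_eq0 (negPf z_neq0). Qed.

(** On nonzero elements every orbit of multiplication by [z] has exactly [m] points:
    [z ^+ i * x = x] with [x != 0] forces [m %| i]. *)
Lemma dvdn_card_mul_stable B : mul_stable B -> (m %| #|B :\ 0%R|)%N.
Proof.
move=> /mul_stableD1 Bz; have zI : injective ( *%R z) := mulfI z_neq0.
have iterz i x : iter i ( *%R z) x = z ^+ i * x.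
  by elim: i => [|i IHi]; rewrite ?mul1r //= IHi exprS mulrA.
suff oB : B :\ 0 \subset fingraph.order_set ( *%R z) m.
  rewrite -(fcard_order_set zI oB) ?dvdn_mull // => x _ /eqP <-.
  exact/esym/Bz.
apply/subsetP => x /setD1P[x_neq0 _]; rewrite inE eqn_leq; apply/andP; split.
  rewrite /fingraph.order -[leqRHS]card_ord.
  apply: leq_trans (leq_image_card (fun i : 'I_m => z ^+ i * x) predT).
  apply/subset_leq_card/subsetP=> y /iter_findex <-; rewrite iterz.
  apply/imageP; exists (Ordinal (ltn_pmod (findex ( *%R z) x y) m_gt0)) => //=.
  by rewrite prim_expr_mod.
apply: dvdn_leq; first exact: fingraph.order_gt0.
rewrite (prim_order_dvd z_prim); apply/eqP/(mulIf x_neq0).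
by rewrite mul1r -iterz iter_order.
Qed.

(** Reindexing by multiplication by [z] multiplies the sum by [z ^+ j]. *)
Lemma power_sum_mul_stable B j :
  mul_stable B -> z ^+ j != 1 -> \sum_(x in B) x ^+ j = 0.
Proof.
move=> Bz zj; set s := \sum_(_ in _) _.
have : s = z ^+ j * s.
  rewrite {1}/s (reindex_inj (mulfI z_neq0)) /= mulr_sumr.
  by apply: eq_big => [x|x _]; rewrite ?Bz ?exprMn.
move/eqP; rewrite -subr_eq0 -{1}[s]mul1r -mulrBl mulf_eq0 subr_eq0 eq_sym.
by rewrite (negPf zj) => /eqP.
Qed.

(* The periods of B form an F_p[z]-submodule containing the unit z - 1. *)
Lemma mul_stable_translate B : z != 1 -> mul_stable B ->
  mul_stable [set s + 1 | s in B] -> forall x, (x + 1 \in B) = (x \in B).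
Proof.
move=> z_neq1 Bz B1z; pose per h := forall x, (x + h \in B) = (x \in B).
have perz h : per h -> per (z * h).
  move=> Bh x; rewrite -[x](mulVKf z_neq0) -mulrDr !Bz; exact: Bh.
have perB a b : per a -> per b -> per (a - b).
  by move=> Ba Bb x; rewrite addrA -[LHS]Bb addrNK.
have memB1 x : (x + 1 \in [set s + 1 | s in B]) = (x \in B).
  exact: (mem_imset _ _ (addIr 1)).
(* Shifting by 1 turns [x + (z - 1) \in B] into membership of [x + z] in the translate of [B], where
   [z] can be factored out. *)
have perz1 : per (z - 1).
  move=> x; rewrite -memB1 -addrA addrNK.
  have -> : x + z = z * (z^-1 * x + 1) by rewrite mulrDr mulr1 mulVKf.
  by rewrite B1z memB1 -Bz mulVKf.
have perX j : per ((z - 1) ^+ j.+1).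
  elim: j => [|j IHj]; first exact: perz1.
  by rewrite exprS mulrBl mul1r; apply: perB => //; apply: perz.
(* The nonzero element [z - 1] has power 1 at exponent [#|K| - 1], so 1 is a period. *)
have := perX #|K|.-2; have q_gt1 := finNzRing_gt1 K.
suff -> : (z - 1) ^+ #|K|.-2.+1 = 1 by [].
have z1 : z - 1 != 0 by rewrite subr_eq0.
apply: (mulfI z1); rewrite -exprS mulr1 -[RHS]expf_card; congr (_ ^+ _).
by case: #|K| q_gt1 => [|[|q]].
Qed.

Lemma mul_stable_addX B : mul_stable B ->
  (forall x, (x + 1 \in B) = (x \in B)) ->
  forall i x, (x + z ^+ i \in B) = (x \in B).
Proof.
move=> Bz B1 i x; have zi_neq0 : z ^+ i != 0 by rewrite expf_neq0.
have -> : x + z ^+ i = z ^+ i * (x / z ^+ i + 1).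
  by rewrite mulrDr mulr1 mulrC divfK.
by rewrite mul_stable_expr // B1 -(mul_stable_expr i) // mulrC divfK.
Qed.

(** * Growth of stable sets under translation by 1 *)

Lemma leq_card_mul_stable (S T : {set K}) : (1 < m)%N ->
    mul_stable S -> mul_stable T -> (forall s, s \in S -> s + 1 \in T) ->
  (#|S :\ 0%R| <= #|T :\ 0%R|)%N.
Proof.
move=> m_gt1 Sz Tz ST.
have /subset_leq_card : [set s + 1 | s in S] \subset T.
  by apply/subsetP => _ /imsetP[s /ST ? ->].
rewrite card_imset; last exact: addIr.
have [/dvdnP[a Sa] /dvdnP[b Tb]] :=
  (dvdn_card_mul_stable Sz, dvdn_card_mul_stable Tz).
rewrite (cardsD1 0 S) (cardsD1 0 T) Sa Tb leq_pmul2r // => le_ST.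
(* The nonzero counts are multiples of [m], while 0 shifts a cardinality by at most 1, less than
   [m]. *)
rewrite leqNgt; apply/negP => lt_ba; have := leq_mul lt_ba (leqnn m); rewrite mulSn.
by case: (0 \in S) (0 \in T) le_ST => [] []; lia.
Qed.

Lemma growth_or_periodic (S T : {set K}) : (2 < m)%N ->
    mul_stable S -> mul_stable T -> (forall s, s \in S -> s + 1 \in T) ->
  (#|S :\ 0%R| + m <= #|T :\ 0%R|)%N \/
  exists B : {set K}, [/\ B = S \/ B = 0 |: S, mul_stable B
    & forall x, (x + 1 \in B) = (x \in B)].
Proof.
move=> m_gt2 Sz Tz ST; have [|small] := leqP; [by left | right].
have z1 : z != 1.
  by rewrite -[z]expr1 -(prim_order_dvd z_prim) gtnNdvd // ltnW.
have z2 : z ^+ 2 != 1 by rewrite -(prim_order_dvd z_prim) gtnNdvd.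
(* A rise by less than [m] between multiples of [m] is no rise. *)
have leTS : (#|T :\ 0%R| <= #|S :\ 0%R|)%N.
  have [/dvdnP[a Sa] /dvdnP[b Tb]] :=
    (dvdn_card_mul_stable Sz, dvdn_card_mul_stable Tz).
  by move: small; rewrite Sa Tb addnC -mulSn ltn_pmul2r // leq_pmul2r.
set S1 := [set s + 1 | s in S].
have cardS1 : #|S1| = #|S| by rewrite card_imset //; apply: addIr.
have S1T : S1 \subset T by apply/subsetP => _ /imsetP[s /ST ? ->].
have [cST|cST] := leqP #|T| #|S|.
  exists S; split=> //; first by left.
  apply: mul_stable_translate => //.
  suff <- : T = [set s + 1 | s in S] by [].
  by apply/eqP; rewrite eq_sym eqEcard S1T cardS1.
(* [T] is larger than [S] without having more nonzero elements, so only [T] contains 0. *)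
have S0 : 0 \notin S.
  apply/negP => S0; move: cST leTS.
  rewrite (cardsD1 0 S) (cardsD1 0 T) S0.
  by move: #|T :\ 0| #|S :\ 0| => t s; case: (0 \in T); lia.
have cTS1 : #|T :\: S1| = 1%N.
  have := cardsID S1 T; rewrite (setIidPr S1T) cardS1.
  move: cST leTS; rewrite (cardsD1 0 S) (cardsD1 0 T) (negPf S0).
  by move: #|T :\ 0| #|S :\ 0| #|T :\: S1| => t s r; case: (0 \in T); lia.
have /cards1P[c Tc] : #|T :\: S1| == 1%N by rewrite cTS1.
have S1c : c \notin S1.
  by have := set11 c; rewrite -Tc inE => /andP[].
have TE : T = c |: S1.
  by rewrite -Tc setUC -{1}(setID T S1) (setIidPr S1T).
have sumT j : \sum_(x in T) x ^+ j = c ^+ j + \sum_(s in S) (s + 1) ^+ j.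
  rewrite TE big_setU1 //=; congr (_ + _).
  by rewrite big_imset //= => x y _ _; apply: addIr.
(* As [m > 2], neither [z] nor [z ^+ 2] is 1, so power sums of degrees 1 and 2 vanish on both sets;
   hence [c] and [c ^+ 2] both equal [- #|S|%:R]. *)
have p1 := power_sum_mul_stable (j := 1) Sz z1.
have p2 := power_sum_mul_stable Sz z2.
have q1 := power_sum_mul_stable (j := 1) Tz z1.
have q2 := power_sum_mul_stable Tz z2.
rewrite !sumT in q1 q2.
have {}q1 : c + #|S|%:R = 0.
  rewrite -q1 expr1; congr (_ + _).
  under [RHS]eq_bigr => s _ do rewrite expr1.
  by rewrite big_split /= p1 add0r sumr_const.
have {}q2 : c ^+ 2 + #|S|%:R = 0.
  rewrite -q2; congr (_ + _).
  under [RHS]eq_bigr => s _ do rewrite sqrrD1.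
  by rewrite 2!big_split sumrMnl p2 [X in X *+ 2]p1 sumr_const mul0rn /= !add0r.
have : c * (c - 1) = 0.
  apply/eqP; rewrite mulrBr mulr1 -expr2 subr_eq0.
  by apply/eqP/(addIr #|S|%:R); rewrite q1 q2.
(* If [c = 0], the translate of [S] is [T :\ 0]; if [c = 1 = 0 + 1], the translate of [0 |: S] is
   [T]. *)
move/eqP; rewrite mulf_eq0 subr_eq0 => /orP[]/eqP c01.
  exists S; split=> //; first by left.
  apply: mul_stable_translate => //.
  suff -> : [set s + 1 | s in S] = T :\ 0 by apply: mul_stableD1.
  by rewrite TE c01 setU1K // -c01.
exists (0 |: S); split; [by right | exact: mul_stableU0 |].
apply: mul_stable_translate => //; first exact: mul_stableU0.
suff -> : [set s + 1 | s in 0 |: S] = T by [].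
by rewrite imsetU1 add0r TE c01.
Qed.

(** * Sums of [n] roots of unity *)

Fixpoint root_sums n : {set K} :=
  if n is n'.+1 then [set s + z ^+ val i | s in root_sums n', i in 'I_m]
  else [set 0].

Lemma root_sums_addX n s i : s \in root_sums n -> s + z ^+ i \in root_sums n.+1.
Proof.
move=> Ss; apply/imset2P; exists s (Ordinal (ltn_pmod i m_gt0)) => //=.
by rewrite prim_expr_mod.
Qed.

Lemma root_sums_ffun n s : s \in root_sums n ->
  exists e : nat -> nat, s = \sum_(i < n) z ^+ e i.
Proof.
elim: n s => [|n IHn] s /=.
  by move/set1P->; exists id; rewrite big_ord0.
case/imset2P => t i /IHn[e ->] _ ->.
exists (fun j => if (j < n)%N then e j else i).
rewrite big_ord_recr /= ltnn; congr (_ + _).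
by apply: eq_bigr => j _; rewrite ltn_ord.
Qed.

Lemma root_sums_stable n : mul_stable (root_sums n).
Proof.
apply: mul_stableP; elim: n => [|n IHn] x.
  by move/set1P->; rewrite mulr0 set11.
case/imset2P => s i /IHn Ss _ ->.
by rewrite mulrDr -exprS; apply: root_sums_addX.
Qed.

Lemma root_sums_nonempty n : exists s, s \in root_sums n.
Proof.
elim: n => [|n [s Ss]]; first by exists 0; apply: set11.
by exists (s + z ^+ 0); apply: root_sums_addX.
Qed.

Lemma root_sums_periodic n (B : {set K}) s :
    (forall i x, (x + z ^+ i \in B) = (x \in B)) ->
  s \in root_sums n -> (s \in B) = (0 \in B).
Proof.
move=> Bz; elim: n s => [|n IHn] s; first by move/set1P->.
by case/imset2P => t i /IHn <- _ ->; apply: Bz.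
Qed.

(** [B] is a union of cosets of the additive span of the roots; the comparison ignores 0 because [S]
    may miss it. *)
Definition periodic_up_to_0 (S : {set K}) := exists B : {set K},
  [/\ 0 \in B, forall i x, (x + z ^+ i \in B) = (x \in B) & S :\ 0 = B :\ 0].

Lemma root_sums_growth n : (2 < m)%N ->
  (n * m <= #|root_sums n :\ 0%R|)%N \/ periodic_up_to_0 (root_sums n).
Proof.
move=> m_gt2; have grow j := growth_or_periodic m_gt2 (@root_sums_stable j)
  (@root_sums_stable j.+1) (fun s => @root_sums_addX j s 0).
have periodic j :
  periodic_up_to_0 (root_sums j) -> periodic_up_to_0 (root_sums j.+1).
  move=> [B [B0 Bz SB]]; exists B; split=> //.
  (* Periodicity keeps the new sums in [B], and the number of nonzero sums cannot drop. *)
  apply/eqP; rewrite eqEcard; apply/andP; split.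
    apply/subsetP=> x; rewrite !inE => /andP[-> /(root_sums_periodic Bz) ->].
    by rewrite B0.
  rewrite -SB; apply: leq_card_mul_stable (ltnW m_gt2) _ _ _.
  - exact: root_sums_stable.
  - exact: root_sums_stable.
  - exact: (fun s => @root_sums_addX j s 0).
elim: n => [|n IHn]; first by left; rewrite mul0n.
case: IHn => [IHn|/periodic]; last by right.
case: (grow n) => [le_n|[B [BS Bz B1]]].
  by left; rewrite mulSn addnC; apply: leq_trans le_n; rewrite leq_add2r.
right; apply: periodic; exists B.
have BX := mul_stable_addX Bz B1.
have [s Ss] := root_sums_nonempty n.
have B0 : 0 \in B.
  rewrite -(root_sums_periodic BX Ss).
  by case: BS => ->; rewrite ?inE Ss ?orbT.
split=> //; case: BS => -> //.
by apply/setP=> x; rewrite !inE; case: eqP.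
Qed.

(** With full growth every nonzero element of [K] is a sum; in the periodic case [B] contains 0 and
    has period 1, hence contains [p.-1%:R = -1]. *)
Lemma opp1_root_sums n : (2 < m)%N -> (#|K|.-1 <= n * m)%N ->
  -1 \in root_sums n.
Proof.
move=> m_gt2 le_n; suff : -1 \in root_sums n :\ 0 by case/setD1P.
case: (root_sums_growth n m_gt2) => [le_nm|[B [B0 Bz ->]]].
  suff -> : root_sums n :\ 0 = setT :\ 0 by rewrite !inE oppr_eq0 oner_neq0.
  apply/eqP; rewrite eqEcard setSD ?subsetT //=.
  apply: leq_trans le_nm; move: le_n.
  by rewrite -cardsT (cardsD1 0) inE.
rewrite !inE oppr_eq0 oner_neq0 /=.
have Bn j : j%:R \in B.
  by elim: j => [//|j IHj]; rewrite -natr1 -(expr0 z) Bz.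
have [p p_pr pK] := finPcharP K.
suff <- : p.-1%:R = -1 :> K by apply: Bn.
apply/eqP; rewrite -addr_eq0 natr1 prednK ?prime_gt0 //.
by rewrite (pcharf0 pK).
Qed.

Lemma root_sum_eq0 n : (2 < m)%N -> (#|K|.-1 <= n * m)%N ->
  exists e : nat -> nat, \sum_(i < n.+1) z ^+ e i = 0.
Proof.
move=> m_gt2 le_n; have S0 := root_sums_addX 0 (opp1_root_sums m_gt2 le_n).
rewrite addNr in S0; have [e e0] := root_sums_ffun S0.
by exists e.
Qed.

End RootSums.

(** * Sums of signs, for [m = 2] *)

Lemma sum_signr_double (R : pzRingType) a : \sum_(i < a.*2) (-1) ^+ i = 0 :> R.
Proof.
elim: a => [|a IHa]; first by rewrite big_ord0.
by rewrite doubleS 2!big_ord_recr /= IHa exprS mulN1r add0r subrr.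
Qed.

(** For even [n] alternating signs cancel; for odd [n], [p] terms equal to 1 sum to 0 and leave an
    even number of alternating signs. *)
Lemma sign_sum_eq0 (R : nzRingType) p n : p \in [pchar R] -> odd p ->
  (p <= n)%N -> exists e : nat -> nat, \sum_(i < n) (-1) ^+ e i = 0 :> R.
Proof.
move=> pR p_odd le_pn; have [n_odd|n_even] := boolP (odd n); last first.
  exists id; rewrite -(even_halfK n_even).
  exact: sum_signr_double.
have np_even : ~~ odd (n - p) by rewrite oddB // n_odd p_odd.
exists (fun i => if (i < p)%N then 0%N else (i - p)%N).
rewrite -(subnKC le_pn) big_split_ord /=.
under eq_bigr => i _ do rewrite ltn_ord expr0.
under [X in _ + X]eq_bigr => i _ do rewrite ltnNge leq_addr /= addKn.
rewrite sumr_const card_ord (pcharf0 pR) add0r.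
rewrite -(even_halfK np_even); exact: sum_signr_double.
Qed.

(** * Generator of the multiplicative group, and transfer to the algebraic closure *)

Lemma prim_root_finField (K : finFieldType) :
  exists g : K, #|K|.-1.-primitive_root g.
Proof.
have q_gt0 : (0 < #|K|.-1)%N by have := finNzRing_gt1 K; case: #|K| => [|[]].
have /hasP[g _ g_prim] : has #|K|.-1.-primitive_root (enum [set~ (0 : K)]).
  apply: has_prim_root; rewrite ?enum_uniq // -?cardE ?cardsC1 //.
  apply/allP=> x; rewrite mem_enum !inE => x_neq0; apply/unity_rootP.
  apply: (mulfI x_neq0); rewrite -exprS prednK ?expf_card ?mulr1 //.
  by rewrite ltnW ?finNzRing_gt1.
by exists g.
Qed.

(* The common root of X^m - 1 and sum_i X^(e i) yields a nontrivial gcd over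
   F_p, which therefore also has a root in the algebraic closure. *)
Lemma weight_set_root_sum (K : finFieldType) p m n (z : K) (e : nat -> nat) :
    p \in [pchar K] -> (0 < m)%N -> z ^+ m = 1 ->
  \sum_(i < n) z ^+ e i = 0 -> weight_set p m n.
Proof.
move=> pK m_gt0 zm ze0; pose L := pPrimeCharType pK.
pose f : {poly 'F_p} := 'X^m - 1; pose h : {poly 'F_p} := \sum_(i < n) 'X^(e i).
have fE (R : fieldType) (i : {rmorphism 'F_p -> R}) x :
  root (map_poly i f) x = (x ^+ m == 1).
  by rewrite rmorphB rmorph1 /= map_polyXn rootE !hornerE subr_eq0.
have hE (R : fieldType) (i : {rmorphism 'F_p -> R}) x :
  root (map_poly i h) x = (\sum_(j < n) x ^+ e j == 0).
  rewrite rmorph_sum /= rootE horner_sum; congr (_ == _).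
  by apply: eq_bigr => j _; rewrite map_polyXn hornerXn.
have szf : size (gcdp f h) != 1%N.
  apply/negP; rewrite -(size_map_poly (in_alg L)) gcdp_map => /coprimep_root.
  move=> /(_ z); rewrite fE zm eqxx => /(_ isT).
  by rewrite -rootE hE ze0 eqxx.
case: (tagged (countable_algebraic_closure 'F_p)) => i _.
have /closed_rootP[w] : size (map_poly i (gcdp f h)) != 1%N.
  by rewrite size_map_poly.
rewrite gcdp_map root_gcd fE hE => /andP[/eqP wm /eqP we].
by exists (fun j => w ^+ e j); split=> // j; rewrite exprAC wm expr1n.
Qed.

Theorem theorem1p3 (p k : nat) (hp : prime p) (hk : (1 <= k)%N)
    (K : finFieldType) (hK : #|K| = (p ^ k)%N)
    (m d : nat) (hm : (1 <= m)%N) (hmK : (m %| p ^ k - 1)%N)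
    (hd : d = ((p ^ k - 1) %/ m)%N)
    (hm1 : m <> 1%N) (hmk : (m, k) <> (2%N, 1%N)) :
  (forall n : nat, (d < n)%N ->
     exists x : 'I_n -> K,
       (forall i, x i != 0) /\ \sum_(i < n) x i ^+ d = 0)
  /\ (forall n : nat, (d + 1 <= n)%N -> weight_set p m n).
Proof.
have pK := card_finPcharP hK hp.
have [g] := prim_root_finField K; rewrite hK -subn1 => g_prim.
have z_prim := dvdn_prim_root g_prim hmK; rewrite -hd in z_prim.
have dm : (d * m = p ^ k - 1)%N by rewrite hd divnK.
have g_neq0 : g != 0.
  apply/eqP=> g0; have := prim_expr_order g_prim.
  have g_gt0 := prim_order_gt0 g_prim.
  by move/eqP; rewrite g0 expr0n gtn_eqF // eq_sym oner_eq0.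
(* One vanishing sum serves both conclusions: take [x i = g ^+ e i] in [K], or transfer the sum to
   the closure. *)
have sums n : (d < n)%N ->
    exists e : nat -> nat, \sum_(i < n) (g ^+ d) ^+ e i = 0.
  case: n => // n; rewrite ltnS => le_dn.
  have [m_gt2|m_le2] := ltnP 2 m.
    apply: (root_sum_eq0 z_prim m_gt2).
    by rewrite hK -subn1 -dm leq_mul2r le_dn orbT.
  have m2 : m = 2%N by lia.
  have zN1 : g ^+ d = -1.
    have /eqP := prim_expr_order z_prim.
    rewrite m2 sqrf_eq1 => /orP[]/eqP // z1.
    by move: (prim_order_dvd z_prim 1%N); rewrite expr1 z1 eqxx dvdn1 => /eqP.
  have k_gt1 : (1 < k)%N by move: hk hmk; rewrite m2; case: (k) => [|[|]].
  have p_odd : odd p.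
    (* For [p = 2] the number [p ^ k - 1] is odd, so it is not [d * 2]. *)
    have [p2|//] := even_prime hp.
    move: dm; rewrite m2 p2 -(prednK hk) expnS.
    by have := expn_gt0 2 k.-1; lia.
  rewrite zN1; apply: (sign_sum_eq0 pK p_odd).
  apply: leq_trans (leqW le_dn).
  (* From [p >= 3] and [k >= 2], [2 * d + 1 = p ^ k >= 3 * p], so [d >= p]. *)
  have p_gt2 : (2 < p)%N by rewrite odd_prime_gt2.
  have := leq_trans (leq_mul p_gt2 (leqnn p)) (leq_pexp2l (prime_gt0 hp) k_gt1).
  by move: dm; rewrite m2; lia.
split=> n lt_dn.
  have [e e0] := sums n lt_dn; exists (fun i => g ^+ e i).
  split=> [i|]; first by rewrite expf_neq0.
  by rewrite -[RHS]e0; apply: eq_bigr => i _; rewrite exprAC.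
rewrite addn1 in lt_dn; have [e e0] := sums n lt_dn.
exact: weight_set_root_sum pK hm (prim_expr_order z_prim) e0.
Qed.
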